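(* For $a \in \bar{\mathbb{Q}}$ let $C_{242,a} \subset \mathbb{P}^4$, with homogeneous coordinates $(q:s:t:u:z)$, be the curve \[ V\big(az^2 - t^2 - (tz - s^2),\; az^2 - t^2 - (-tz - u^2),\; az^2 - t^2 - (sz - q^2)\big). \] The values $a$ for which $C_{242,a}$ is singular are exactly $a \in \{-\tfrac14, 0, 2, a_1, a_2, a_3\}$, where $a_1, a_2, a_3$ are the three $3^{\mathrm{rd}}$ critical values of $f_c$.
   Context: $f_c(x) = x^2 + c$. The three $3^{\mathrm{rd}}$ critical values of $f_c$ are the numbers $a = f_{c_0}^3(0) = (c_0^2+c_0)^2 + c_0$ where $c_0$ is a root of $\frac{d}{dc} f_c^3(0) = 4c^3 + 6c^2 + 2c + 1$. The curve $C_{242,a}$ parametrizes $c$ for which $a$ has rational pre-images $\pm t$, $\pm s$, $\pm u$ (with $s^2 + c = t$, $u^2 + c = -t$) and $\pm q$ (with $q^2 + c = s$). *)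

(* Defs.v *)
(* Mathematical Components, with multinomials for polynomials in several
   variables.  The field \bar Q is algC. *)
From HB Require Import structures.
From mathcomp Require Import all_boot all_order all_algebra all_field.
From mathcomp.multinomials Require Import mpoly.

Set Implicit Arguments.
Unset Strict Implicit.
Unset Printing Implicit Defensive.

Import Order.TTheory GRing.Theory Num.Theory.
Local Open Scope ring_scope.

(* The ring is arbitrary so that the parameter c may also be the polynomial
   indeterminate. *)
Definition fc (R : nzRingType) (c x : R) : R := x ^+ 2 + c.

(* f_c^n(0) as a polynomial in c. *)
Definition crit_orbit_poly (R : nzRingType) (n : nat) : {poly R} :=
  iter n (fc 'X) 0.

Lemma horner_crit_orbit_poly (R : comNzRingType) (n : nat) (c : R) :
  (crit_orbit_poly R n).[c] = iter n (fc c) 0.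
Proof.
rewrite /crit_orbit_poly; elim: n => [|n IHn] /=; first by rewrite horner0.
by rewrite {1}/fc hornerD horner_exp hornerX IHn.
Qed.

Definition critical_value (n : nat) (a : algC) : Prop :=
  exists2 c0 : algC, root (crit_orbit_poly algC n)^`() c0
                   & a = iter n (fc c0) 0.

Section ProjectiveCurve.

(* Closed subschemes V(F_0, ..., F_(m-1)) of P^n with the F_i homogeneous; a
   point of P^n is given by any nonzero vector of homogeneous coordinates. *)
Variables (n m : nat) (F : 'I_m -> {mpoly algC[n.+1]}).

Definition on_V (P : 'rV[algC]_n.+1) : Prop :=
  P != 0 /\ forall i, (F i).@[P 0] = 0.

Definition jacobian (P : 'rV[algC]_n.+1) : 'M[algC]_(m, n.+1) :=
  \matrix_(i, j) ((F i)^`M(j)).@[P 0].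

(* Jacobian criterion for a scheme of pure dimension 1: P is a regular point
   iff the Jacobian matrix has rank n - 1, the codimension; equivalently P is
   singular iff the Zariski tangent space at P has dimension
   n - \rank (jacobian P) > 1. *)
Definition singular_at (P : 'rV[algC]_n.+1) : Prop :=
  on_V P /\ (\rank (jacobian P) < n.-1)%N.

Definition singular_curve : Prop := exists P, singular_at P.

End ProjectiveCurve.

(* Equations of C_{242,a} in P^4.  The hyperplane z = 0 meets their zero locus
   in the eight points (+-1 : +-1 : 1 : +-1 : 0) only, so it has pure
   dimension 1 for every a, as singular_curve requires. *)
Definition C242 (a : algC) : 'I_3 -> {mpoly algC[5]} :=
  let q : {mpoly algC[5]} := 'X_(@Ordinal 5 0 isT) in
  let s : {mpoly algC[5]} := 'X_(@Ordinal 5 1 isT) in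
  let t : {mpoly algC[5]} := 'X_(@Ordinal 5 2 isT) in
  let u : {mpoly algC[5]} := 'X_(@Ordinal 5 3 isT) in
  let z : {mpoly algC[5]} := 'X_(@Ordinal 5 4 isT) in
  tnth [tuple a *: z ^+ 2 - t ^+ 2 - (t * z - s ^+ 2);
              a *: z ^+ 2 - t ^+ 2 - (- (t * z) - u ^+ 2);
              a *: z ^+ 2 - t ^+ 2 - (s * z - q ^+ 2)].

(* Main.v *)
(* No point with z = 0 is singular, so set z = 1 and c = a - t^2.  A point is
   singular iff some (x, y, w) != 0 kills the Jacobian matrix from the left.
   If w = 0, the column equations force c = -1/2 and a = -1/4, or t = c = 0 and
   a = 0.  If w != 0, then q = 0, hence s = c and t = f_c^2(0); either u = 0,
   so that f_c^2(0) = -c, giving c = -2 and a = 2 (c = 0 is excluded), or y = 0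
   and the remaining equation 4 s t + 2 t + 1 = 0 says that f_c^3(0) is critical
   in c.  Modulo p = 4 c^3 + 6 c^2 + 2 c + 1 one has f_c^3(0) = -(2 c^2 - 4 c + 1)/8,
   so two distinct roots of p with the same value would add up to 2 and leave
   -7/2 as the third root, but p(-7/2) != 0. *)
Require Import Defs.
From HB Require Import structures.
From mathcomp Require Import all_boot all_order all_algebra all_field.
From mathcomp.multinomials Require Import mpoly.
From mathcomp Require Import ring.

Import Order.TTheory GRing.Theory Num.Theory.
Local Open Scope ring_scope.

(** * Left kernels and explicit row vectors *)

(** For three quadrics in P^4 the bound [n.-1] of [singular_at] equals the number [m] of equations,
    so a singular point is one with a nontrivial linear relation between the gradients. *)
Lemma rank_ltP (K : fieldType) (m n : nat) (A : 'M[K]_(m, n)) :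
  reflect (exists2 v : 'rV[K]_m, v != 0 & v *m A = 0) (\rank A < m)%N.
Proof.
rewrite ltn_neqAle rank_leq_row andbT.
apply: (equivP idP); rewrite -[_ == m]/(row_free A) -kermx_eq0.
split=> [/rowV0Pn[v /sub_kermxP vA v0]|[v v0 vA]]; first by exists v.
by apply/rowV0Pn; exists v => //; apply/sub_kermxP.
Qed.

Definition row_of (R : nmodType) (n : nat) (r : seq R) : 'rV[R]_n :=
  \row_j r`_j.
Arguments row_of {R} n r.

Lemma row_of_surj (R : nmodType) (n : nat) (v : 'rV[R]_n) :
  exists2 r, size r = n & v = row_of n r.
Proof.
exists [seq v 0 j | j : 'I_n]; first by rewrite size_map -cardE card_ord.
apply/rowP => j; rewrite mxE (nth_map j) ?nth_ord_enum //.
by rewrite size_enum_ord.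
Qed.

Lemma row_of_eq0 (R : nmodType) (n : nat) (r : seq R) :
  size r = n -> (row_of n r == 0) = all (eq_op^~ 0) r.
Proof.
move=> <-.
apply/eqP/(all_nthP 0) => [/rowP r0 i lt_ir|r0].
  by have:= r0 (Ordinal lt_ir); rewrite !mxE => ->.
by apply/rowP => j; rewrite !mxE; apply/eqP/r0.
Qed.

(** * Equations and Jacobian matrix of the curve *)

Lemma meval_mderivXU (R : comNzRingType) (n : nat) (v : 'I_n -> R)
    (i j : 'I_n) : ('X_i^`M(j)).@[v] = (i == j)%:R.
Proof.
rewrite mderivX mevalZ mnm1E; case: eqP => [->|_]; last by rewrite mul0r.
by rewrite -{1}[U_(j)%MM]add0m addmK mpolyX0 meval1 mulr1.
Qed.

Definition mderiv_simp := (@mderivB, @mderivN, @mderivZ, @mderivM).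
Definition meval_simp :=
  (@mevalB, @mevalN, @mevalD, @mevalZ, @mevalM, @mevalXU, @meval_mderivXU).

Lemma on_V_C242P (a q s t u z : algC) :
  on_V (C242 a) (row_of 5 [:: q; s; t; u; z]) <->
  [/\ ~~ all (eq_op^~ 0) [:: q; s; t; u; z],
      a * z ^+ 2 - t ^+ 2 = t * z - s ^+ 2,
      a * z ^+ 2 - t ^+ 2 = - (t * z) - u ^+ 2
    & a * z ^+ 2 - t ^+ 2 = s * z - q ^+ 2].
Proof.
rewrite /on_V -(row_of_eq0 _ 5) //.
split=> [[-> F0]|[-> h0 h1 h2]].
  have := (F0 (@Ordinal 3 0 isT), F0 (@Ordinal 3 1 isT),
    F0 (@Ordinal 3 2 isT)).
  rewrite /C242 !(tnth_nth 0) /= !expr2 !meval_simp !mxE /=.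
  by move=> -[[/subr0_eq ? /subr0_eq ?] /subr0_eq ?].
split=> // -[[|[|[|//]]] j3];
  rewrite /C242 !(tnth_nth 0) /= !expr2 !meval_simp !mxE /=;
  by apply/eqP; rewrite subr_eq0; apply/eqP.
Qed.

Lemma jacobian_C242_ker (a q s t u z x y w : algC) :
  row_of 3 [:: x; y; w] *m jacobian (C242 a) (row_of 5 [:: q; s; t; u; z]) =
  row_of 5 [:: 2 * q * w; 2 * s * x - z * w;
    - (2 * t + z) * x + (z - 2 * t) * y - 2 * t * w; 2 * u * y;
    (2 * a * z - t) * x + (2 * a * z + t) * y + (2 * a * z - s) * w].
Proof.
apply/rowP => j; rewrite !mxE !big_ord_recl big_ord0 /jacobian !mxE.
rewrite /C242 !(tnth_nth 0) /=.
rewrite !expr2 !mderiv_simp !meval_simp !mxE /=.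
move: j => -[[|[|[|[|[|//]]]]] j5] /=; ring.
Qed.

Lemma singular_C242_affineP (a : algC) :
  singular_curve (C242 a) <->
  exists q s t u x y w : algC,
    [/\ ~~ all (eq_op^~ 0) [:: x; y; w],
        [/\ a - t ^+ 2 = t - s ^+ 2, a - t ^+ 2 = - t - u ^+ 2
          & a - t ^+ 2 = s - q ^+ 2]
      & [/\ q * w = 0, 2 * s * x = w,
            (1 - 2 * t) * y = (2 * t + 1) * x + 2 * t * w, u * y = 0
          & (2 * a - t) * x + (2 * a + t) * y + (2 * a - s) * w = 0]].
Proof.
split=> [[P []]|[q [s [t [u [x [y [w [v0 [h0 h1 h2] [k0 k1 k2 k3 k4]]]]]]]]]].
  have [r] := row_of_surj _ _ P.
  case: r => [|q [|s [|t [|u [|z []]]]]] // _ ->{P}.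
  move=> /on_V_C242P[P0 h0 h1 h2] /rank_ltP[v v0].
  have [r] := row_of_surj _ _ v.
  case: r => [|x [|y [|w []]]] // _ Ev.
  move: v0; rewrite Ev jacobian_C242_ker row_of_eq0 // => v0 /eqP.
  rewrite row_of_eq0 //= => /and5P[/eqP k0 /eqP k1 /eqP k2 /eqP k3].
  rewrite andbT => /eqP k4.
  (* At z = 0 the equations read q^2 = s^2 = u^2 = t^2. If t = 0 all coordinates vanish; otherwise
     q, u, s are nonzero and their columns give w = y = x = 0. *)
  have z0 : z != 0.
    apply: contraNneq P0 => z0; move: h0 h1 h2.
    rewrite z0 expr0n !mulr0 oppr0 !sub0r => /oppr_inj h0 /oppr_inj h1.
    move=> /oppr_inj h2; have [t0|t0] := eqVneq t 0.
      move/eqP: h0 h1 h2; rewrite t0 expr0n eq_sym sqrf_eq0 /= => -> /eqP.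
      by rewrite eq_sym sqrf_eq0 => -> /eqP; rewrite eq_sym sqrf_eq0 !eqxx => ->.
    have nz (b : algC) : t ^+ 2 = b ^+ 2 -> b != 0.
      by rewrite -sqrf_eq0 => <-; rewrite sqrf_eq0.
    move/eqP: k0 v0; rewrite !mulf_eq0 pnatr_eq0 (negPf (nz _ h2)) /= => ->.
    move/eqP: k3; rewrite !mulf_eq0 pnatr_eq0 (negPf (nz _ h1)) /= => ->.
    move/eqP: k1; rewrite z0 mul0r subr0 !mulf_eq0 pnatr_eq0.
    by rewrite (negPf (nz _ h0)) /= => ->.
  (* The Jacobian entries are linear in the coordinates, so scaling the point by 1/z keeps the
     kernel vector. *)
  exists (q / z), (s / z), (t / z), (u / z), x, y, w; split => //; split.
  (* Replacing [a] by the value that the equation at hand gives turns the goal into an identity of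
     fractions. *)
  - have -> : a = (t * z - s ^+ 2 + t ^+ 2) / z ^+ 2 by rewrite -h0; field.
    by field.
  - have -> : a = (- (t * z) - u ^+ 2 + t ^+ 2) / z ^+ 2 by rewrite -h1; field.
    by field.
  - have -> : a = (s * z - q ^+ 2 + t ^+ 2) / z ^+ 2 by rewrite -h2; field.
    by field.
  - have /eqP := k0; rewrite -mulrA mulf_eq0 pnatr_eq0 /= => /eqP k0'.
    by rewrite mulrAC k0' mul0r.
  - have -> : w = 2 * s * x / z by rewrite (subr0_eq k1); field.
    by field.
  - apply/eqP; rewrite -subr_eq0; apply/eqP.
    by rewrite -[RHS](mul0r z^-1) -k2; field.
  - have /eqP := k3; rewrite -mulrA mulf_eq0 pnatr_eq0 /= => /eqP k3'.
    by rewrite mulrAC k3' mul0r.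
  - by rewrite -[RHS](mul0r z^-1) -k4; field.
exists (row_of 5 [:: q; s; t; u; 1]); split.
  by apply/on_V_C242P; rewrite /= oner_eq0 !andbF expr1n !mulr1.
apply/rank_ltP; exists (row_of 3 [:: x; y; w]); first by rewrite row_of_eq0.
apply/eqP; rewrite jacobian_C242_ker row_of_eq0 //= !mulr1 mul1r.
rewrite -!mulrA k0 k3 !mulr0 !mulrA k1 k4 subrr eqxx /= andbT.
by apply/eqP; rewrite k2; ring.
Qed.

(** * Parameters with a singular point *)

Lemma critical_value3P (a : algC) :
  critical_value 3 a <->
  exists2 c : algC, 4 * c ^+ 3 + 6 * c ^+ 2 + 2 * c + 1 = 0
                  & a = (c ^+ 2 + c) ^+ 2 + c.
Proof.
have dE (c : algC) : (crit_orbit_poly algC 3)^`().[c] =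
    4 * c ^+ 3 + 6 * c ^+ 2 + 2 * c + 1.
  rewrite /crit_orbit_poly /= /fc !expr2 !(derivD, derivM, derivX, derivC).
  rewrite !(hornerD, hornerM, hornerX, hornerC).
  ring.
have vE (c : algC) : iter 3 (fc c) 0 = (c ^+ 2 + c) ^+ 2 + c.
  by rewrite /= /fc; ring.
split=> -[c c0 ->]; exists c => //.
- by apply/eqP; rewrite -dE.
- by rewrite rootE dE c0.
Qed.

Lemma singular_C242P (a : algC) :
  singular_curve (C242 a) <->
  [\/ a = - (1 / 4%:R), a = 0, a = 2 | critical_value 3 a].
Proof.
split.
  move=> /singular_C242_affineP[q [s [t [u [x [y [w]]]]]]].
  move=> [v0 [h0 h1 h2] [k0 k1 k2 k3 _]].
  have Ea : a = t - s ^+ 2 + t ^+ 2 by rewrite -h0; ring.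
  have [w0|w0] := eqVneq w 0.
    have [x0|x0] := eqVneq x 0.
      have y0 : y != 0 by move: v0; rewrite /= x0 w0 eqxx /= andbT.
      have u0 : u = 0 by move/eqP: k3; rewrite mulf_eq0 (negPf y0) orbF => /eqP.
      have t2 : t = 1 / 2.
        move/eqP: k2; rewrite x0 w0 !mulr0 addr0 mulf_eq0 (negPf y0) orbF.
        rewrite subr_eq0 => /eqP t2.
        by transitivity (2 * t / 2); [field | rewrite -t2].
      constructor 1.
      have -> : a = - t - u ^+ 2 + t ^+ 2 by rewrite -h1; ring.
      by rewrite u0 t2; field.
    have s0 : s = 0.
      by move/eqP: k1; rewrite w0 !mulf_eq0 pnatr_eq0 (negPf x0) orbF => /eqP.
    have [y0|y0] := eqVneq y 0.
      constructor 1; rewrite Ea s0.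
      move/esym/eqP: k2; rewrite y0 w0 !mulr0 addr0 mulf_eq0 (negPf x0) orbF.
      rewrite addr_eq0 => /eqP t2; have -> : t = - 1 / 2 by rewrite -t2; field.
      by field.
    have u0 : u = 0 by move/eqP: k3; rewrite mulf_eq0 (negPf y0) orbF => /eqP.
    have t0 : t = 0.
      have : 2 * t = 0 by rewrite -[RHS](subrr (a - t ^+ 2)) {1}h0 h1 s0 u0; ring.
      by move/eqP; rewrite mulf_eq0 pnatr_eq0 => /eqP.
    by constructor 2; rewrite Ea s0 t0; ring.
  have q0 : q = 0 by move/eqP: k0; rewrite mulf_eq0 (negPf w0) orbF => /eqP.
  have [x0 s0] : x != 0 /\ s != 0.
    by move: w0; rewrite -k1 !mulf_eq0 !negb_or -andbA => /and3P[].
  have Et : t = s ^+ 2 + s.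
    have : a - t ^+ 2 = s by rewrite h2 q0; ring.
    by rewrite h0 => /eqP; rewrite subr_eq addrC => /eqP.
  have [y0|y0] := eqVneq y 0.
    constructor 4; apply/critical_value3P; exists s; last by rewrite Ea Et; ring.
    (* With y = 0 and w = 2 s x, the t-column is x (4 s t + 2 t + 1) = 0. *)
    apply/eqP; rewrite -(inj_eq (mulIf x0)) mul0r; apply/eqP.
    by rewrite -[RHS](mulr0 (1 - 2 * t)) -[in RHS]y0 k2 -k1 Et; ring.
  have u0 : u = 0 by move/eqP: k3; rewrite mulf_eq0 (negPf y0) orbF => /eqP.
  constructor 3; rewrite Ea Et.
  (* With u = 0 the first two equations give 2 t = s^2, that is, s (s + 2) = 0. *)
  have -> : s = - 2.
    apply/eqP; rewrite -addr_eq0 -(inj_eq (mulIf s0)) mul0r; apply/eqP.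
    rewrite -[RHS](subrr (a - t ^+ 2)) {1}h0 h1 Et u0; ring.
  by ring.
move=> a_vals; apply/singular_C242_affineP.
case: a_vals => [->|->|->|/critical_value3P[c c0 ->]].
- exists (sqrtC (1 / 2)), 0, (- 1 / 2), 1, 1, 0, 0.
  by rewrite /= oner_eq0 !sqrtCK; split=> //; split; field.
- exists 0, 0, 0, 0, 1, 1, 0.
  by rewrite /= oner_eq0; split=> //; split; ring.
(* Here w = 2 s x = -4 x and the t-column gives 3 y = 11 x; x = 3 clears the denominator. *)
- exists 0, (- 2), 2, 0, 3, 11, (- 12).
  by rewrite /= pnatr_eq0; split=> //; split; ring.
- exists 0, c, (c ^+ 2 + c), (sqrtC (- c ^+ 2 - 2 * c)), 1, 0, (2 * c).
  rewrite /= oner_eq0 !sqrtCK; split=> //; split; try ring.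
    by rewrite mulr0 -c0; ring.
  (* The z-column equals t = c^2 + c times the critical polynomial at c. *)
  by rewrite -[RHS](mulr0 (c ^+ 2 + c)) -[in RHS]c0; ring.
Qed.

(** * Distinctness of the three critical values *)

(** The factorization is symmetric in the roots, so permuting them separates every pair of values.
    The case x = y is excluded as well, so simplicity of the roots is proved here too. *)
Lemma crit_value3_neq (x y z : algC) :
    (forall c, 4 * c ^+ 3 + 6 * c ^+ 2 + 2 * c + 1 =
       4 * ((c - x) * (c - y) * (c - z))) ->
  (x ^+ 2 + x) ^+ 2 + x != (y ^+ 2 + y) ^+ 2 + y.
Proof.
pose p (c : algC) := 4 * c ^+ 3 + 6 * c ^+ 2 + 2 * c + 1.
(* Vieta's formulas, obtained by evaluating both sides at 0, 1 and -1. *)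
move=> pF; have e3 : x * y * z = - (1 / 4).
  transitivity (- p 0 / 4); last by rewrite /p; field.
  by rewrite /p pF; field.
have e1 : x + y + z = - (3 / 2).
  transitivity (- (p 1 + p (- 1)) / 8 - x * y * z).
    by rewrite /p !pF; field.
  by rewrite e3 /p; field.
have e2 : x * y + x * z + y * z = 1 / 2.
  transitivity (p 1 / 4 - 1 + (x + y + z) + x * y * z).
    by rewrite /p pF; field.
  by rewrite e1 e3 /p; field.
have p0 c : c \in [:: x; y; z] -> p c = 0.
  by rewrite /p pF !inE => /or3P[] /eqP->; ring.
apply/eqP => xy.
(* The factor c + 1/2 is the quotient of 4 ((c^2 + c)^2 + c) by [p]; the remainder is -c^2 + 2 c -
   1/2. *)
have : (x - y) * (2 - x - y) = 0.
  transitivity (4 * ((x ^+ 2 + x) ^+ 2 + x - ((y ^+ 2 + y) ^+ 2 + y))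
    - p x * (x + 1 / 2) + p y * (y + 1 / 2)); first by rewrite /p; field.
  by rewrite xy !p0 ?inE ?eqxx ?orbT //; ring.
have Ez : z = - (3 / 2) - x - y by rewrite -e1; ring.
move/eqP; rewrite mulf_eq0 => /orP[/eqP/subr0_eq Exy|/eqP Exy].
  (* y = 1 because p = (4 y + 2) D - 2 (y - 1) / 3 with
     D = (6 y ^+ 2 + 6 y + 1) / 6, but D does not vanish at 1. *)
  have d0 : 6 * y ^+ 2 + 6 * y + 1 = 0.
    transitivity (1 - 2 * (x * y + x * z + y * z)); last by rewrite e2; field.
    by rewrite Ez Exy; field.
  have y1 : y = 1.
    transitivity (1 - 3 / 2 * p y + (y + 1 / 2) * (6 * y ^+ 2 + 6 * y + 1)).
      by rewrite /p; field.
    by rewrite d0 p0 ?inE ?eqxx ?orbT //; ring.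
  have : (13 : algC) = 0 by rewrite -d0 y1; ring.
  by move/eqP; rewrite pnatr_eq0.
have Ez' : z = - (7 / 2).
  transitivity (2 - x - y - 7 / 2); first by rewrite Ez; field.
  by rewrite Exy; ring.
have : - (104 : algC) = p z by rewrite /p Ez'; field.
by rewrite p0 ?inE ?eqxx ?orbT // => /eqP; rewrite oppr_eq0 pnatr_eq0.
Qed.

Theorem theorem4p5 :
  exists a1 a2 a3 : algC,
    [/\ uniq [:: a1; a2; a3],
        forall x : algC, critical_value 3 x <-> x \in [:: a1; a2; a3]
      & forall a : algC,
          singular_curve (C242 a) <->
          a \in [:: - (1 / 4%:R); 0; 2%:R; a1; a2; a3]].
Proof.
pose p : {poly algC} := Poly [:: 1; 2; 6; 4].
have pE (x : algC) : p.[x] = 4 * x ^+ 3 + 6 * x ^+ 2 + 2 * x + 1.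
  by rewrite horner_Poly /=; ring.
(* The top coefficient 4 is nonzero, so [Poly] truncates nothing; the size 4 then forces exactly
   three roots, counted with multiplicity. *)
have sp : p = [:: 1; 2; 6; 4] :> seq algC by rewrite (@PolyK _ 0) //= pnatr_eq0.
have [r] := closed_field_poly_normal p.
rewrite lead_coefE sp /= => Ep.
have: size p = (size r).+1.
  by rewrite Ep size_scale ?pnatr_eq0 // size_prod_XsubC.
rewrite sp; case: r Ep => [|c1 [|c2 [|c3 []]]] //= Ep _.
have pF (x : algC) : 4 * x ^+ 3 + 6 * x ^+ 2 + 2 * x + 1 =
    4 * ((x - c1) * (x - c2) * (x - c3)).
  by rewrite -pE Ep hornerZ !big_cons big_nil !hornerM !hornerXsubC hornerC; ring.
have f4 : (4 : algC) != 0 by rewrite pnatr_eq0.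
pose g (c : algC) := (c ^+ 2 + c) ^+ 2 + c.
have cvP (x : algC) : critical_value 3 x <-> x \in [:: g c1; g c2; g c3].
  split=> [/critical_value3P[c /eqP]|].
    rewrite pF !mulf_eq0 (negPf f4) !subr_eq0 /= => c123 ->; rewrite !inE.
    by case/orP: c123 => [/orP[]|] /eqP->; rewrite eqxx ?orbT.
  rewrite !inE => x123; apply/critical_value3P.
  case/or3P: x123 => /eqP->; [exists c1|exists c2|exists c3] => //;
    by rewrite pF; ring.
exists (g c1), (g c2), (g c3); split=> // [|a].
  rewrite /= !inE negb_or andbT -andbA; apply/and3P; split.
  - exact: (crit_value3_neq c1 c2 c3).
  - by apply: (crit_value3_neq c1 c3 c2); move=> c; rewrite pF; ring.
  - by apply: (crit_value3_neq c2 c3 c1); move=> c; rewrite pF; ring.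
apply: (iff_trans (singular_C242P a)); split.
  by rewrite !inE => -[->|->|->|/cvP]; rewrite ?eqxx ?orbT // !inE => ->;
    rewrite !orbT.
rewrite in_cons => /orP[/eqP|]; first by constructor 1.
rewrite in_cons => /orP[/eqP|]; first by constructor 2.
rewrite in_cons => /orP[/eqP|/cvP]; first by constructor 3.
by constructor 4.
Qed.
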